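(* For every $\varepsilon > 0$ there exist $C = C(\varepsilon) > 0$ and $k_0 = k_0(\varepsilon) > 0$ such that the following holds. Let $k$ and $\ell$ be integers satisfying $k \ge k_0$ and $Ck \le \ell \le \binom{k}{2} - Ck$. Then $$\mathrm{ind}(k,\ell) \le \frac{1}{2} + \varepsilon.$$
   Context: All graphs are finite and simple. For a positive integer $k$ and a graph $G$ with at least $k$ vertices, let $A = A_{G,k}$ be chosen uniformly at random from all $k$-element subsets of $V(G)$, and let $X_{G,k} = e(G[A])$ be the number of edges of $G$ with both endpoints in $A$. For integers $n \ge k$ and $0 \le \ell \le \binom{k}{2}$ let $I(n,k,\ell) = \max\{\mathbb{P}(X_{G,k} = \ell) : G \text{ is a graph on } n \text{ vertices}\}$. For fixed $k,\ell$ the sequence $I(n,k,\ell)$ is non-increasing in $n$, and the edge-inducibility is defined by $\mathrm{ind}(k,\ell) := \lim_{n\to\infty} I(n,k,\ell)$. *)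

(* Defs.v *)
From HB Require Import structures.
From mathcomp Require Import all_boot all_order all_algebra.
From mathcomp Require Import all_classical all_reals all_analysis.
Set Implicit Arguments.
Unset Strict Implicit.
Unset Printing Implicit Defensive.
Import Order.TTheory GRing.Theory Num.Theory.
Import numFieldNormedType.Exports.
Local Open Scope ring_scope.
Local Open Scope classical_set_scope.

(* A finite simple graph on T is represented by its set of edges, each edge
   being the unordered pair (2-element set) of its endpoints. *)
Definition simple_graph (T : finType) (E : {set {set T}}) : bool :=
  [forall e in E, #|e| == 2%N].

Definition induced_edges (T : finType) (E : {set {set T}}) (A : {set T}) :
  {set {set T}} := [set e in E | e \subset A]%SET.

Definition ksubsets (T : finType) (k : nat) : {set {set T}} :=
  [set A : {set T} | #|A| == k]%SET.

(* P(X_{G,k} = l) for a uniformly random k-subset A, where X_{G,k} = e(G[A]).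
   It is only meaningful for k <= #|T|; otherwise the quotient is 0 / 0 = 0. *)
Definition prob_edges (R : realType) (T : finType) (E : {set {set T}})
    (k l : nat) : R :=
  #|[set A in ksubsets T k | #|induced_edges E A| == l]%SET|%:R
    / #|ksubsets T k|%:R.

(* The default 0 of the iterated maximum is harmless: the range contains the
   empty graph and all the values are nonnegative. *)
Definition max_prob (R : realType) (n k l : nat) : R :=
  \big[Num.max/0]_(E : {set {set 'I_n}} | simple_graph E)
    prob_edges R E k l.

(* The terms with n < k are all 0 and do not affect the limit; from n = k on
   the sequence is nonincreasing and bounded below by 0, hence convergent. *)
Definition ind (R : realType) (k l : nat) : R :=
  limn (fun n : nat => max_prob R n k l).

(* Main.v *)
Require Import Defs.
From mathcomp Require Import all_boot all_order all_algebra.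
From mathcomp Require Import all_classical all_reals all_analysis.
From mathcomp Require Import zify ring lra.
Import Order.TTheory GRing.Theory Num.Theory.
Import numFieldNormedType.Exports.
Local Open Scope ring_scope.
Set Implicit Arguments.
Unset Strict Implicit.
Unset Printing Implicit Defensive.

(* As n grows, a random k-set becomes a k-tuple of independent vertices, up to
   an error k^2 / n.  Let p be the edge density; passing to the complement, we
   may assume p <= 1/2.  If p < C / k, Markov's inequality gives
   P(X = l) <= 1/2 since l >= C k.  Otherwise split the tuple as S ++ B with
   |S| = s of order T / p, and resample S into S'.  Both S ++ B and S' ++ B are
   uniform, so 2 P(X = l) - 1 <= P(e(S ++ B) = e(S' ++ B)), and it is enough to
   show that the latter is small.  The difference of the two counts is the sum
   over b in B of f(b) = deg_S(b) - deg_S'(b), up to e(S) - e(S'), which is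
   o(k) because e(S) has mean at most s^2 p / 2.
   At least p / 20 of the vertices b have neither very small nor very large
   degree; as s p is large, f(b) <> 0 for half of them, with high probability.
   Given this, either f is not concentrated on one value, and the sum over B
   is anticoncentrated; or f takes mostly one value c <> 0, and the sum is close
   to c |B|, too large to be cancelled by e(S) - e(S'). *)

(** * Averages over vertices and over tuples of independent vertices *)

Section Mean.
Variables (R : realFieldType) (V : finType).

Definition mean (g : V -> R) : R := (\sum_v g v) / #|V|%:R.

(** The expectation of [F] over [k] independent uniform vertices, repetitions allowed. *)
Fixpoint mean_seq (k : nat) (F : seq V -> R) : R :=
  if k is k'.+1 then mean (fun v => mean_seq k' (fun s => F (v :: s)))
  else F [::].

Lemma eq_mean (g h : V -> R) : g =1 h -> mean g = mean h.
Proof. by move=> gh; rewrite /mean (eq_bigr h). Qed.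

Lemma mean_le (g h : V -> R) : (forall v, g v <= h v) -> mean g <= mean h.
Proof. by move=> gh; rewrite /mean ler_wpM2r ?invr_ge0 ?ler0n // ler_sum. Qed.

Lemma meanD (g h : V -> R) : mean (fun v => g v + h v) = mean g + mean h.
Proof. by rewrite /mean big_split mulrDl. Qed.

Lemma meanZ (c : R) (g : V -> R) : mean (fun v => c * g v) = c * mean g.
Proof. by rewrite /mean -mulr_sumr mulrA. Qed.

Lemma mean_exchange (g : V -> V -> R) :
  mean (fun v => mean (g v)) = mean (fun u => mean (g ^~ u)).
Proof. by rewrite /mean -!mulr_suml exchange_big. Qed.

Lemma eq_mean_seq k (F G : seq V -> R) :
  (forall s, size s = k -> F s = G s) -> mean_seq k F = mean_seq k G.
Proof.
elim: k F G => [|k IH] F G FG /=; first exact: FG.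
by apply: eq_mean => v; apply: IH => s sk; apply: FG; rewrite /= sk.
Qed.

Lemma mean_seq_le k (F G : seq V -> R) :
  (forall s, size s = k -> F s <= G s) -> mean_seq k F <= mean_seq k G.
Proof.
elim: k F G => [|k IH] F G FG /=; first exact: FG.
by apply: mean_le => v; apply: IH => s sk; apply: FG; rewrite /= sk.
Qed.

Lemma mean_seqD k (F G : seq V -> R) :
  mean_seq k (fun s => F s + G s) = mean_seq k F + mean_seq k G.
Proof.
elim: k F G => [|k IH] F G //=.
by rewrite -meanD; apply: eq_mean => v; apply: IH.
Qed.

Lemma mean_seqZ k (c : R) (F : seq V -> R) :
  mean_seq k (fun s => c * F s) = c * mean_seq k F.
Proof.
elim: k F => [|k IH] F //=.
by rewrite -meanZ; apply: eq_mean => v; apply: IH.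
Qed.

Lemma mean_seq_mean k (F : seq V -> V -> R) :
  mean_seq k (fun s => mean (F s)) = mean (fun v => mean_seq k (F ^~ v)).
Proof.
elim: k F => [|k IH] F //=.
by rewrite [RHS]mean_exchange; apply: eq_mean => v; apply: IH.
Qed.

Lemma mean_seq_cat a b (F : seq V -> R) :
  mean_seq (a + b) F = mean_seq a (fun s => mean_seq b (fun t => F (s ++ t))).
Proof.
elim: a F => [|a IH] F //=.
by apply: eq_mean => v; rewrite IH.
Qed.

Lemma mean_seq_tuple k (F : seq V -> R) :
  mean_seq k F = (\sum_(t : k.-tuple V) F t) / #|V|%:R ^+ k.
Proof.
elim: k F => [|k IH] F /=.
  rewrite (big_pred1 [tuple]) ?expr0 ?divr1 // => t /=.
  by apply/esym/eqP/tuple0.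
rewrite /mean exprSr invfM mulrA; congr (_ / _).
rewrite (eq_bigr _ (fun v _ => IH (fun s => F (v :: s)))).
rewrite -mulr_suml; congr (_ / _).
rewrite pair_big /=.
rewrite (reindex (fun t : k.+1.-tuple V => (thead t, [tuple of behead t]))) /=.
  by apply: eq_bigr => t _; rewrite [in RHS](tuple_eta t).
exists (fun p : V * k.-tuple V => [tuple of p.1 :: p.2]) => [t _|[v t] _] /=.
  by rewrite -tuple_eta.
by rewrite theadE; congr pair; apply: val_inj.
Qed.

Hypothesis V_gt0 : (0 < #|V|)%N.

Lemma mean_const (c : R) : mean (fun=> c) = c.
Proof.
by rewrite /mean sumr_const -[X in X / _]mulr_natr mulfK // pnatr_eq0 -lt0n.
Qed.

Lemma mean_seq_const k (c : R) : mean_seq k (fun=> c) = c.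
Proof.
elim: k => [|k IH] //=.
by rewrite -[RHS]mean_const; apply: eq_mean.
Qed.

Lemma mean_bool_itv (P : pred V) : 0 <= mean (fun v => (P v)%:R) <= 1.
Proof.
apply/andP; split; first by rewrite -(mean_const 0); apply: mean_le.
by rewrite -[leRHS]mean_const; apply: mean_le => v; case: (P v).
Qed.

Lemma meanC (P : pred V) :
  mean (fun v => (~~ P v)%:R) = 1 - mean (fun v => (P v)%:R).
Proof.
apply/eqP; rewrite eq_sym subr_eq -meanD -[X in X == _]mean_const; apply/eqP.
by apply: eq_mean => v; case: (P v); rewrite /= ?addr0 ?add0r.
Qed.

Lemma mean_seq_count k (P : pred V) :
  mean_seq k (fun s => (count P s)%:R) = k%:R * mean (fun v => (P v)%:R).
Proof.
elim: k => [|k IH] /=; first by rewrite mul0r.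
rewrite -[RHS]mean_const.
under eq_mean => v.
  under eq_mean_seq => s _ do rewrite natrD.
  rewrite mean_seqD mean_seq_const IH; over.
by rewrite meanD !mean_const -natr1 mulrDl mul1r addrC.
Qed.

Lemma markov_mean_seq k (F : seq V -> R) (c : R) : 0 < c ->
  (forall s, size s = k -> 0 <= F s) ->
  mean_seq k (fun s => (c <= F s)%R%:R) <= mean_seq k F / c.
Proof.
move=> c0 F0; rewrite mulrC -mean_seqZ; apply: mean_seq_le => s sk.
case: (leP c (F s)) => h /=; first by rewrite mulrC ler_pdivlMr // mul1r.
by rewrite mulr_ge0 ?invr_ge0 ?F0 // ltW.
Qed.

End Mean.

(** * Nonnegative polynomials as laws, and binomial point probabilities *)

Section Antichain.
Variable R : realFieldType.
Implicit Types P Q : {poly R}.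

Definition coef_ge0 P := forall i, 0 <= P`_i.

Definition cumul P (t : nat) : R := \sum_(i < t.+1) P`_i.

Lemma cumulB P Q t : cumul (P - Q) t = cumul P t - cumul Q t.
Proof. by rewrite /cumul -sumrB; apply: eq_bigr => i _; rewrite coefB. Qed.

(** Taking cumulative sums is multiplying by 1 / (1 - X), so it can be moved onto one factor of a
    product. *)
Lemma cumulM P Q t : cumul (P * Q) t = \sum_(i < t.+1) P`_i * cumul Q (t - i).
Proof.
rewrite /cumul; elim: t => [|t IH].
  by rewrite !big_ord1 coefM !big_ord1.
rewrite big_ord_recr /= IH coefM [in RHS]big_ord_recr /= subnn big_ord1.
rewrite [X in _ + X]big_ord_recr /= subnn addrA; congr (_ + _).
rewrite -big_split /=; apply: eq_bigr => i _.
have it : (i <= t)%N by rewrite -ltnS.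
by rewrite (subSn it) [in RHS]big_ord_recr /= mulrDr.
Qed.

Lemma coef_ge0M P Q : coef_ge0 P -> coef_ge0 Q -> coef_ge0 (P * Q).
Proof. by move=> p q i; rewrite coefM sumr_ge0 // => j _; rewrite mulr_ge0. Qed.

Lemma coef_ge0X P n : coef_ge0 P -> coef_ge0 (P ^+ n).
Proof.
move=> p; elim: n => [|n IH]; first by move=> i; rewrite expr0 coef1 ler0n.
by rewrite exprS; apply: coef_ge0M.
Qed.

Lemma cumul_ge0 P t : coef_ge0 P -> 0 <= cumul P t.
Proof. by move=> p; rewrite sumr_ge0. Qed.

Lemma cumul_le_horner P t : coef_ge0 P -> cumul P t <= P.[1].
Proof.
move=> p; rewrite horner_coef.
under [leRHS]eq_bigr => i _ do rewrite expr1n mulr1.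
pose w := maxn t.+1 (size P).
rewrite /cumul (big_ord_widen w (fun i => P`_i)) ?leq_maxl //.
rewrite [leRHS](big_ord_widen w (fun i => P`_i)) ?leq_maxr //.
rewrite [leRHS]big_mkcond [leLHS]big_mkcond ler_sum // => i _.
case: (ltnP i (size P)) => h; case: ifP => // _.
by rewrite nth_default.
Qed.

(* If A and B are the generating polynomials of two laws, the first living on
   [0, c] and the second on ]c, +oo[, the sum below is the expected number of
   visits to t of a strictly increasing path.  The bound comes from the
   telescoping identity A^(m+1) - B^(m+1) = (A - B) sum_j A^(m-j) B^j, read on
   cumulative sums. *)
Lemma sum_exprM_coef_le1 (A B : {poly R}) (c m t : nat) :
  coef_ge0 A -> coef_ge0 B -> A.[1] = 1 -> B.[1] = 1 ->
  (size A <= c.+1)%N -> (forall i, (i <= c)%N -> B`_i = 0) ->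
  \sum_(j < m.+1) (A ^+ (m - j) * B ^+ j)`_t <= 1.
Proof.
move=> A0 B0 A1 B1 Ac Bc.
set H := \sum_(j < m.+1) (A ^+ (m - j) * B ^+ j).
rewrite -coef_sum -/H.
have H0 : coef_ge0 H.
  move=> i; rewrite coef_sum sumr_ge0 // => j _.
  by apply: coef_ge0M; apply: coef_ge0X.
have cumA u : (c <= u)%N -> cumul A u = 1.
  move=> cu; rewrite -A1 (@horner_coef_wide _ u.+1) ?(leq_trans Ac) //.
  by apply: eq_bigr => i _; rewrite expr1n mulr1.
have cumB u : (u <= c)%N -> cumul B u = 0.
  by move=> uc; apply: big1 => i _; rewrite Bc // (leq_trans _ uc) // -ltnS.
(* A law on [0, c] is stochastically dominated by one living beyond [c]. *)
have cumAB u : 0 <= cumul (A - B) u.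
  rewrite cumulB subr_ge0; case: (leqP u c) => uc.
    by rewrite cumB // cumul_ge0.
  by rewrite cumA ?(ltnW uc) // -B1 cumul_le_horner.
have E : cumul (H * (A - B)) (t + c) <= 1.
  have -> : H * (A - B) = A ^+ m.+1 - B ^+ m.+1 by rewrite mulrC subrXX.
  rewrite cumulB.
  rewrite lerBlDr; apply: le_trans (cumul_le_horner _ (coef_ge0X _ A0)) _.
  by rewrite horner_exp A1 expr1n lerDl cumul_ge0 //; apply: coef_ge0X.
apply: le_trans E; rewrite cumulM.
(* The cumulative sum of [A - B] at [c] is exactly 1, so the term of index [t] is the coefficient of
   [H] itself; the other terms are nonnegative. *)
have tt : (t < (t + c).+1)%N by rewrite ltnS leq_addr.
rewrite (bigD1 (Ordinal tt)) //= addKn cumulB cumA // cumB // subr0 mulr1 lerDl.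
by rewrite sumr_ge0 // => i _; rewrite mulr_ge0.
Qed.

Definition binom_pmf (p q : R) (m j : nat) : R :=
  p ^+ j * q ^+ (m - j) *+ 'C(m, j).

Lemma coef_binom_term (p q : R) P Q m i t :
  (((q *: P) ^+ (m - i) * (p *: Q) ^+ i) *+ 'C(m, i))`_t =
  binom_pmf p q m i * (P ^+ (m - i) * Q ^+ i)`_t.
Proof.
by rewrite !exprZn -scalerAl -scalerAr scalerA scalerMnl coefZ /binom_pmf
  [p ^+ i * _]mulrC.
Qed.

Lemma binom_pmf_ge0 p q m j : 0 <= p -> 0 <= q -> 0 <= binom_pmf p q m j.
Proof. by move=> p0 q0; rewrite mulrn_wge0 // mulr_ge0 // exprn_ge0. Qed.

Lemma binom_pmf_rev p q m j : (j <= m)%N ->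
  binom_pmf p q m (m - j) = binom_pmf q p m j.
Proof. by move=> jm; rewrite /binom_pmf subKn // bin_sub // mulrC. Qed.

Lemma sum_binom_pmf_le1 (p q : R) m n :
  0 <= p -> 0 <= q -> p + q = 1 -> \sum_(i < n) binom_pmf p q m i <= 1.
Proof.
move=> p0 q0 pq.
have <- : \sum_(i < m.+1) binom_pmf p q m i = 1.
  rewrite -(expr1n R m) -pq addrC exprDn.
  by apply: eq_bigr => i _; rewrite /binom_pmf mulrC.
rewrite (big_ord_widen (maxn n m.+1)) ?leq_maxl //.
rewrite [leRHS](big_ord_widen (maxn n m.+1)) ?leq_maxr //.
rewrite [leRHS]big_mkcond [leLHS]big_mkcond ler_sum // => i _.
case: (ltnP i m.+1) => h; case: ifP => // _; first exact: binom_pmf_ge0.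
by rewrite /binom_pmf bin_small.
Qed.

Lemma binom_pmfS (p q : R) m j :
  binom_pmf p q m j.+1 * (j.+1%:R * q) = binom_pmf p q m j * ((m - j)%:R * p).
Proof.
case: (ltnP j m) => jm; last first.
  by rewrite /binom_pmf bin_small // mulr0n mul0r (eqP jm) mul0r mulr0.
have := mul_bin_left m j => /(congr1 (fun n => n%:R : R)); rewrite !natrM => E.
have [n mn] : {n | (m - j)%N = n.+1} by exists (m - j.+1)%N; rewrite subnSK.
have mn' : (m - j.+1)%N = n by rewrite subnS mn.
move: E; rewrite /binom_pmf mn mn' => E.
rewrite -(mulr_natr _ 'C(m, j)) -(mulr_natr _ 'C(m, j.+1)).
rewrite (exprS p j) (exprS q n).
transitivity ((j.+1%:R * 'C(m, j.+1)%:R) * (p * p ^+ j * q ^+ n * q)).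
  by ring.
by rewrite E; ring.
Qed.

(** Up to the mean, the mass function cannot drop fast: on the [N] values starting at [j] it stays
    at least half its value at [j], and these masses sum to at most 1. *)
Lemma binom_pmf_small_low (p q : R) m j N : (0 < N)%N ->
  0 <= p -> 0 <= q -> p + q = 1 -> 4 * N%:R ^+ 2 <= m%:R * p * q ->
  j%:R <= m%:R * p ->
  binom_pmf p q m j <= 2 / N%:R.
Proof.
move=> N0 p0 q0 pq hN jp.
have N1 : (1 : R) <= N%:R by rewrite ler1n.
set b := binom_pmf p q m; set v := m%:R * p * q in hN *.
have b0 i : 0 <= b i by apply: binom_pmf_ge0.
have v0 : 0 < v by nra.
have q1 : 0 < q.
  rewrite lt_neqAle q0 andbT; apply/eqP => E.
  by move: v0; rewrite /v -E mulr0 ltxx.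
(* Each ratio of successive masses is at least (v - N) / (v + N) >= 1 - 2 N / v = 1 - x, and [N]
   such losses total at most 1 / 2. *)
pose x := 2 * N%:R / v.
have xv : x * v = 2 * N%:R by rewrite /x divfK // gt_eqF.
have x0 : 0 <= x by rewrite divr_ge0 ?mulr_ge0 ?ler0n // ltW.
have xN : x * N%:R <= 2^-1.
  rewrite /x mulrAC ler_pdivrMr //; nra.
have x1 : x <= 1 by nra.
have step i : (i < N)%N -> b (j + i)%N * (1 - x) <= b (j + i).+1.
  move=> iN; have iN' : i%:R + 1 <= N%:R :> R by rewrite natr1 ler_nat.
  have i0 : (0 : R) <= i%:R by [].
  have d0 : 0 < (j + i).+1%:R * q by rewrite mulr_gt0 // ltr0n.
  rewrite -(ler_pM2r d0) binom_pmfS -mulrA ler_wpM2l //.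
  have sub : m%:R - j%:R - i%:R <= (m - (j + i))%:R :> R.
    case: (leqP (j + i) m) => h; first by rewrite natrB // natrD opprD addrA.
    rewrite (eqP (ltnW h)) -addrA -opprD -natrD subr_le0 ler_nat; exact: ltnW.
  apply: le_trans (_ : (m%:R - j%:R - i%:R) * p <= _); last first.
    by rewrite ler_wpM2r.
  rewrite -natr1 natrD.
  have A : (m%:R - j%:R - i%:R) * p >= v - N%:R by rewrite /v; nra.
  have B : (j%:R + i%:R + 1) * q <= v + N%:R by rewrite /v; nra.
  apply: le_trans A; apply: le_trans (_ : (1 - x) * (v + N%:R) <= _).
    by rewrite ler_wpM2l // subr_ge0.
  by rewrite mulrBl mul1r mulrDr xv; nra.
have low i : (i <= N)%N -> b j * (1 - i%:R * x) <= b (j + i)%N.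
  elim: i => [|i IH] iN; first by rewrite mul0r subr0 mulr1 addn0.
  rewrite addnS; apply: le_trans (step _ iN).
  apply: le_trans (_ : b j * (1 - i%:R * x) * (1 - x) <= _); last first.
    by rewrite ler_wpM2r ?subr_ge0 // IH // ltnW.
  rewrite -mulrA ler_wpM2l // -natr1.
  have : (0 : R) <= i%:R by [].
  nra.
have S := sum_binom_pmf_le1 m (j + N) p0 q0 pq.
rewrite ler_pdivlMr ?ltr0n //.
suff : b j * (N%:R / 2) <= 1 by lra.
apply: le_trans S; rewrite big_split_ord /=.
apply: le_trans (_ : \sum_(i < N) b (j + i)%N <= _); last first.
  by rewrite lerDr sumr_ge0.
have -> : b j * (N%:R / 2) = \sum_(i < N) b j / 2.
  by rewrite sumr_const card_ord -[RHS]mulr_natr; ring.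
apply: ler_sum => i _; apply: le_trans (low _ (ltnW (ltn_ord i))).
rewrite ler_wpM2l //.
have : i%:R <= N%:R :> R by rewrite ler_nat ltnW.
nra.
Qed.

(** Exchanging [p] with [q] and [j] with [m - j] reduces to values up to the mean. *)
Lemma binom_pmf_small (p q : R) m j N : (0 < N)%N -> (j <= m)%N ->
  0 <= p -> 0 <= q -> p + q = 1 -> 4 * N%:R ^+ 2 <= m%:R * p * q ->
  binom_pmf p q m j <= 2 / N%:R.
Proof.
move=> N0 jm p0 q0 pq hN.
case: (leP j%:R (m%:R * p)) => h; first exact: binom_pmf_small_low.
rewrite -binom_pmf_rev //; apply: binom_pmf_small_low => //.
- by rewrite addrC.
- by rewrite mulrAC.
- by rewrite natrB //; nra.
Qed.

End Antichain.

(** * Anticoncentration of sums of independent values *)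

Section Anticoncentration.
Variables (R : realFieldType) (V : finType).
Hypothesis V_gt0 : (0 < #|V|)%N.
Implicit Types (f : V -> nat) (P : pred V).

Definition gen_poly P f : {poly R} := \sum_(v | P v) #|V|%:R^-1 *: 'X^(f v).

Lemma coef_ge0_gen_poly P f : coef_ge0 (gen_poly P f).
Proof.
move=> i; rewrite coef_sum sumr_ge0 // => v _.
by rewrite coefZ coefXn mulr_ge0 ?invr_ge0.
Qed.

Lemma horner1_gen_poly P f : (gen_poly P f).[1] = mean (fun v => (P v)%:R).
Proof.
rewrite horner_sum /mean big_mkcond mulr_suml; apply: eq_bigr => v _.
by case: (P v); rewrite ?hornerZ ?hornerXn ?expr1n ?mul1r ?mulr1 ?mul0r.
Qed.

Lemma mean_seq_coef f m (t : nat) :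
  mean_seq m (fun s => (\sum_(v <- s) f v == t)%N%:R) =
  ((gen_poly predT f) ^+ m)`_t.
Proof.
elim: m t => [|m IH] t /=; first by rewrite big_nil expr0 coef1 eq_sym.
rewrite exprS mulr_suml coef_sum /mean mulr_suml; apply: eq_bigr => v _.
rewrite -scalerAl coefZ coefXnM mulrC; congr (_ * _).
case: ltnP => h.
  rewrite -[RHS](mean_seq_const V_gt0 m); apply: eq_mean_seq => s _.
  by rewrite big_cons; case: eqP => // E; lia.
rewrite -IH; apply: eq_mean_seq => s _; rewrite big_cons.
by rewrite -{1}(subnKC h) eqn_add2l.
Qed.

(** Split the draws by whether [f] exceeds [c]. The number of draws exceeding [c] is binomial, with
    point masses at most 2 / N; the coefficients that they multiply sum to at most 1 by
    [sum_exprM_coef_le1]. *)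
Lemma anticoncentration f c m N (t : nat) : (0 < N)%N ->
  let p : R := mean (fun v => (c < f v)%N%:R) in
  4 * N%:R ^+ 2 <= m%:R * p * (1 - p) ->
  mean_seq m (fun s => (\sum_(v <- s) f v == t)%N%:R) <= 2 / N%:R :> R.
Proof.
move=> N0 p hN; pose P v := (c < f v)%N; pose q := 1 - p.
have N1 : (1 : R) <= N%:R by rewrite ler1n.
have /andP[p_ge0 p_le1] : 0 <= p <= 1 := mean_bool_itv R V_gt0 P.
have q_ge0 : 0 <= q by rewrite subr_ge0.
have pq : p + q = 1 by rewrite addrC subrK.
have m0 : 0 <= m%:R :> R by [].
have p0 : p != 0 by apply/eqP => E; move: hN; rewrite E; nra.
have q0 : q != 0 by apply/eqP => E; move: hN; rewrite -/q E; nra.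
(* [A] and [B] generate the laws of [f] conditioned on being at most [c] and above [c]. *)
pose A := q^-1 *: gen_poly (predC P) f; pose B := p^-1 *: gen_poly P f.
have AB : gen_poly predT f = q *: A + p *: B.
  by rewrite !scalerA !mulfV // !scale1r addrC /gen_poly (bigID P).
rewrite mean_seq_coef AB exprDn coef_sum.
have A0 : coef_ge0 A.
  by move=> i; rewrite coefZ mulr_ge0 ?invr_ge0 //; apply: coef_ge0_gen_poly.
have B0 : coef_ge0 B.
  by move=> i; rewrite coefZ mulr_ge0 ?invr_ge0 //; apply: coef_ge0_gen_poly.
have H : \sum_(j < m.+1) (A ^+ (m - j) * B ^+ j)`_t <= 1.
  apply: (@sum_exprM_coef_le1 _ _ _ c) => //.
  - by rewrite hornerZ horner1_gen_poly /= meanC // mulVf.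
  - by rewrite hornerZ horner1_gen_poly mulVf.
  - apply: leq_trans (size_scale_leq _ _) _.
    apply: leq_trans (size_sum _ _ _) _; apply/bigmax_leqP => v cv.
    by rewrite (leq_trans (size_scale_leq _ _)) // size_polyXn ltnS leqNgt.
  - move=> i ic; rewrite coefZ coef_sum big1 ?mulr0 // => v cv.
    rewrite coefZ coefXn; case: eqP => [E'|_]; last by rewrite mulr0.
    by move: cv; rewrite /P -E' ltnNge ic.
under eq_bigr => i _ do rewrite coef_binom_term.
apply: le_trans
  (_ : \sum_(j < m.+1) 2 / N%:R * (A ^+ (m - j) * B ^+ j)`_t <= _).
  apply: ler_sum => i _; rewrite ler_wpM2r //.
    by apply: coef_ge0M; apply: coef_ge0X.
  by apply: binom_pmf_small; rewrite // -ltnS.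
by rewrite -mulr_sumr ler_piMr // divr_ge0.
Qed.

(** For rho >= 0, take the first [c] at which the distribution function reaches rho / 2: at most rho
    / 2 lies below [c] and at most 1 - rho on [c], so at least rho / 2 lies above. Complementary
    masses of at least rho / 2 have product at least rho / 4. *)
Lemma spread_threshold f (rho : R) : rho <= 1 ->
  (forall c, rho <= mean (fun v => (f v != c)%:R)) ->
  exists c, let p : R := mean (fun v => (c < f v)%N%:R) in
    rho / 4 <= p * (1 - p).
Proof.
move=> rho1 spread.
pose F c : R := mean (fun v => (f v <= c)%N%:R).
have exF : exists c, rho / 2 <= F c.
  exists (\max_v f v)%N.
  have -> : F (\max_v f v)%N = 1.
    rewrite -(mean_const V_gt0 1); apply: eq_mean => v.
    by rewrite leq_bigmax.
  lra.
case: (ex_minnP exF) => c Fc c_min; exists c => /=.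
have -> : mean (fun v => (c < f v)%N%:R) = 1 - F c.
  by rewrite -meanC //; apply: eq_mean => v; rewrite ltnNge.
have /andP[F0 F1] : 0 <= F c <= 1 := mean_bool_itv R V_gt0 _.
have below : mean (fun v => (f v < c)%N%:R) <= Num.max (0 : R) (rho / 2).
  case: c c_min {Fc F0 F1} => [|c] c_min.
    by rewrite mean_const // le_max lexx.
  rewrite le_max; apply/orP; right; rewrite leNgt; apply/negP => /ltW /c_min.
  by rewrite ltnn.
have := spread c.
have -> : mean (fun v => (f v != c)%:R) =
    mean (fun v => (f v < c)%N%:R) + (1 - F c).
  rewrite -meanC // -meanD; apply: eq_mean => v; rewrite -natrD.
  by congr (_%:R); case: ltngtP.
move: below; rewrite le_max => /orP[] below above; nra.
Qed.

End Anticoncentration.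

(** * Edge counts along vertex sequences *)

(* The relation is symmetric but may have loops, and the vertices may repeat:
   this makes the complement exact (edges_compl) on all tuples. *)
Fixpoint edges (V : Type) (a : rel V) (s : seq V) : nat :=
  if s is v :: s' then (count (a v) s' + edges a s')%N else 0%N.

Lemma edges_cat (V : Type) (a : rel V) (s t : seq V) : symmetric a ->
  edges a (s ++ t) =
  (edges a s + edges a t + \sum_(b <- t) count (a b) s)%N.
Proof.
move=> a_sym; elim: s => [|v s IH] /=.
  by rewrite big1 ?addn0.
rewrite IH count_cat big_split /=.
have -> : count (a v) t = (\sum_(b <- t) a b v)%N.
  rewrite -sum1_count big_mkcond; apply: eq_bigr => b _.
  by rewrite a_sym; case: (a b v).
lia.
Qed.

Lemma edges_compl (V : Type) (a : rel V) (s : seq V) :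
  (edges a s + edges (fun x y => ~~ a x y) s)%N = 'C(size s, 2).
Proof.
elim: s => [|v s IH] //=.
rewrite binS bin1 -IH -(count_predC (a v) s).
have -> : count (predC (a v)) s = count (fun y => ~~ a v y) s by [].
lia.
Qed.

(** Each exceptional term differs from [c] by at most [d]; two inequalities replace an absolute
    value in order to stay in [nat]. *)
Lemma sum_concentrated (V : Type) (f : V -> nat) (c d : nat) (s : seq V) :
  (c <= d)%N -> (forall v, f v <= d)%N ->
  (\sum_(v <- s) f v <= c * size s + d * count (fun v => f v != c) s)%N /\
  (c * size s <= \sum_(v <- s) f v + d * count (fun v => f v != c) s)%N.
Proof.
move=> cd fd; elim: s => [|v s [IH1 IH2]]; first by rewrite big_nil !muln0.
rewrite big_cons /=; have := fd v.
by case: (eqVneq (f v) c) => [->|_] /= h; split; nia.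
Qed.

(** * Sums over the common block, and vertices of intermediate degree *)

Section Coupling.
Variables (R : realFieldType) (V : finType).
Hypothesis V_gt0 : (0 < #|V|)%N.

(** In use, [f] is a difference of degrees shifted by [s], so the value [s] stands for 0. If no
    value carries almost all the mass, [anticoncentration] applies. Otherwise the dominant value [c]
    is not [s], and a total near [s * m] forces many draws with [f v != c], which Markov's
    inequality makes unlikely. *)
Lemma sum_avoid_shifted_mean (f : V -> nat) (k m s N t : nat) :
  (0 < N)%N -> (0 < s)%N -> (0 < k)%N ->
  (forall v, f v <= s + s)%N ->
  let rho : R := 16 * N%:R ^+ 2 / m%:R in
  rho <= mean (fun v => (f v != s)%:R) ->
  k%:R <= 2 * m%:R :> R ->
  8 * `|t%:R - s%:R * m%:R : R| <= k%:R ->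
  48 * N%:R ^+ 3 * s%:R <= k%:R :> R ->
  mean_seq m (fun B => (\sum_(b <- B) f b == t)%N%:R) <= 2 / N%:R :> R.
Proof.
move=> N0 s0 k0 f_le rho spread km ht hs.
have kpos : (0 : R) < k%:R by rewrite ltr0n.
have spos : (0 : R) < s%:R by rewrite ltr0n.
have Npos : (0 : R) < N%:R by rewrite ltr0n.
have mpos : (0 : R) < m%:R by lra.
have rhom : rho * m%:R = 16 * N%:R ^+ 2 by rewrite /rho divfK // gt_eqF.
have /andP[_ rho1'] := mean_bool_itv R V_gt0 (fun v => f v != s).
have rho1 : rho <= 1 := le_trans spread rho1'.
(* Values beyond 2 s are never taken, so finitely many [c] have to be tested. *)
case: (boolP [forall c : 'I_(s + s).+1, rho <= mean (fun v => (f v != c)%:R)]).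
  move=> /forallP all_spread.
  have [c] : exists c, let p : R := mean (fun v => (c < f v)%N%:R) in
      rho / 4 <= p * (1 - p).
    apply: spread_threshold => // c.
    case: (ltnP c (s + s).+1) => h; first exact: (all_spread (Ordinal h)).
    apply: le_trans rho1 _; rewrite -[leLHS](mean_const V_gt0).
    apply: mean_le => v.
    by rewrite neq_ltn (leq_ltn_trans (f_le v)).
  move=> /= hc; apply: (@anticoncentration _ _ _ _ c) => //=.
  rewrite -mulrA; move: hc; set x := _ * (1 - _) => hc; nra.
case/forallPn => c; rewrite -ltNge => conc.
have cs : c != s :> nat.
  by apply/eqP => E; move: conc; rewrite E ltNge spread.
have c_le : (c <= s + s)%N by rewrite -ltnS.
(* The total forces m <= |c - s| m <= 2 s cnt + k / 8; with m >= k / 2 this gives cnt >= 3 k / (16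
   s). *)
pose u : R := 3 * k%:R / (16 * s%:R).
have us : u * s%:R * 16 = 3 * k%:R.
  by rewrite /u; field; rewrite gt_eqF.
have u0 : 0 < u by rewrite divr_gt0 ?mulr_gt0.
pose cnt (B : seq V) : R := (count (fun v => f v != c) B)%:R.
apply: le_trans (_ : mean_seq m (fun B => (u <= cnt B)%R%:R) <= _).
  apply: mean_seq_le => B sB; case: eqP => //= E.
  rewrite (_ : u <= cnt B) //.
  have [] := sum_concentrated B c_le f_le; rewrite E sB.
  rewrite -!(ler_nat R) !natrD !natrM -/(cnt B) natrD => h1 h2.
  have /andP[t_lo t_hi] : - (k%:R / 8) <= (t%:R : R) - s%:R * m%:R <= k%:R / 8.
    by rewrite -ler_norml ler_pdivlMr // mulrC.
  rewrite -(ler_pM2r spos).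
  have : (m%:R : R) <= 2 * (cnt B * s%:R) + k%:R / 8; last by lra.
  case: (ltngtP c s) cs => // lt _.
    have : c%:R + 1 <= s%:R :> R by rewrite natr1 ler_nat.
    rewrite -subr_ge0 => /(mulr_ge0 (ltW mpos)) h; lra.
  have : s%:R + 1 <= c%:R :> R by rewrite natr1 ler_nat.
  rewrite -subr_ge0 => /(mulr_ge0 (ltW mpos)) h; lra.
have cnt0 B : size B = m -> 0 <= cnt B by rewrite ler0n.
apply: le_trans (markov_mean_seq u0 cnt0) _.
rewrite mean_seq_count // ler_pdivrMr // mulrAC ler_pdivlMr //.
apply: le_trans (_ : rho * m%:R * N%:R <= _).
  by rewrite mulrC [leRHS]mulrC [rho * _]mulrC !ler_wpM2l // ltW.
rewrite rhom -(ler_pM2r spos); nra.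
Qed.

Variable a : rel V.
Hypothesis a_sym : symmetric a.

Definition deg (x : V) : R := mean (fun y => (a x y)%:R).
Definition density : R := mean deg.
Definition middling (x : V) : bool :=
  (density / 20 <= deg x) && (deg x <= 4 / 5).

(* Otherwise almost every vertex is of low degree (< density / 20) or of high
   degree (> 4 / 5); counting edges between the two classes from both sides is
   then contradictory. *)
Lemma mean_middling : 0 < density -> density <= 1 / 2 ->
  density / 20 <= mean (fun x => (middling x)%:R).
Proof.
set p := density => p0 p1; rewrite leNgt; apply/negP => mu_lt.
pose H x := 4 / 5 < deg x; pose L x := deg x < p / 20.
set mu := mean _ in mu_lt; pose beta : R := mean (fun x => (H x)%:R).
have deg01 x : 0 <= deg x <= 1 := mean_bool_itv R V_gt0 _.
have cover x : 1 <= (L x)%:R + (H x)%:R + (middling x)%:R :> R.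
  rewrite /L /H /middling -/p; case: (ltP (deg x) (p / 20)) => h1.
    by case: (ltP (4 / 5) (deg x)) => h2 /=; lra.
  by case: (ltP (4 / 5) (deg x)) => h2 /=; lra.
have mu0 : 0 <= mu by case/andP: (mean_bool_itv R V_gt0 middling).
have beta0 : 0 <= beta by case/andP: (mean_bool_itv R V_gt0 H).
have p_le : p <= p / 20 + (beta + mu).
  rewrite -[X in X + _](mean_const V_gt0) -!meanD; apply: mean_le => x.
  have := cover x; have /andP[d0 d1] := deg01 x.
  rewrite {1}/L; case: ltP => h /=; last by lra.
  have : 0 <= (H x)%:R :> R by []. have : 0 <= (middling x)%:R :> R by [].
  lra.
have beta_le : 4 / 5 * beta <= p.
  rewrite -meanZ; apply: mean_le => x; rewrite /H; case: ltP => h /=.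
    by rewrite mulr1 ltW.
  by rewrite mulr0; case/andP: (deg01 x).
(* Double counting of adjacent pairs: a high vertex has at most [beta + mu] of its neighbours
   outside the low class, while a low vertex has degree below p / 20. *)
have crossing : (4 / 5 - (beta + mu)) * beta <= p / 20.
  apply: le_trans (_ : mean (fun x =>
    mean (fun y => (H x)%:R * ((L y)%:R * (a x y)%:R))) <= _).
    rewrite -meanZ; apply: mean_le => x; rewrite meanZ mulrC.
    rewrite {1 2}/H; case: ltP => h; rewrite /= ?mul0r // !mul1r.
    rewrite lerBlDr.
    apply: le_trans (ltW h) _; rewrite -!meanD; apply: mean_le => y.
    have := cover y.
    case: (L y) (H y) (middling y) (a x y) => [] [] [] [] /=; lra.
  rewrite mean_exchange -[leRHS](mean_const V_gt0); apply: mean_le => y.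
  apply: le_trans (_ : mean (fun x => (L y)%:R * (a y x)%:R) <= _).
    apply: mean_le => x; rewrite a_sym.
    by case: (H x); case: (L y); case: (a y x); rewrite /= ?mulr0 ?mul0r ?mul1r.
  rewrite meanZ -/(deg y) /L; case: ltP => h; rewrite ?mul1r ?mul0r ?ltW //.
  by rewrite divr_gt0.
(* Here beta > 9 p / 10, beta <= 5 / 8 and mu < 1 / 40, so the left side of [crossing] exceeds 0.15
   * 0.9 p. *)
nra.
Qed.

Lemma mean_seq_edges k :
  mean_seq k (fun s => (edges a s)%:R) = 'C(k, 2)%:R * density.
Proof.
elim: k => [|k IH] /=; first by rewrite mul0r.
under eq_mean => v.
  under eq_mean_seq => s _ do rewrite natrD.
  rewrite mean_seqD IH mean_seq_count // -/(deg v); over.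
by rewrite meanD meanZ mean_const // binS bin1 natrD addrC mulrDl.
Qed.

End Coupling.

Lemma indicator_add_le (R : numDomainType) (x y : bool) :
  x%:R + y%:R <= 1 + (x && y)%:R :> R.
Proof. by rewrite -natrD -(natrD R 1) ler_nat; case: x; case: y. Qed.

(** * The resampling bound for a fixed relation *)

Section Bound.
Variables (R : realFieldType) (V : finType).
Hypothesis V_gt0 : (0 < #|V|)%N.
Variable a : rel V.
Hypothesis a_sym : symmetric a.
Let p : R := density R a.

(** Adjacency of a middling [b] to a random vertex has variance at least p / 20 * 1 / 5 = p / 100,
    whence the constant 400. *)
Lemma degree_spread (N s : nat) (b : V) (t : nat) : (0 < N)%N ->
  middling R a b -> 400 * N%:R ^+ 2 <= s%:R * p ->
  mean_seq s (fun S => (count (a b) S == t)%:R) <= 2 / N%:R :> R.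
Proof.
move=> N0 /andP[lo hi] hs.
rewrite (@eq_mean_seq _ _ _ _
  (fun S => (\sum_(v <- S) (a b v : nat) == t)%N%:R)); last first.
  move=> S _; rewrite -sum1_count big_mkcond.
  by congr (nat_of_bool (_ == _))%:R; apply: eq_bigr => v _; case: (a b v).
apply: (@anticoncentration _ _ _ _ 0) => //=.
rewrite (_ : mean _ = deg R a b); last by apply: eq_mean => v; case: (a b v).
rewrite -mulrA; rewrite -/p in lo.
have s0 : (0 : R) <= s%:R by [].
apply: le_trans (_ : s%:R * (p / 20 * (1 - 4 / 5)) <= _); first by lra.
rewrite ler_wpM2l //.
have N1 : (1 : R) <= N%:R by rewrite ler1n.
have p0 : 0 <= p by nra.
by apply: ler_pM => //; lra.
Qed.

Lemma bin2_le (k : nat) : 'C(k, 2)%:R <= k%:R ^+ 2 / 2 :> R.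
Proof.
rewrite ler_pdivlMr // -natrX -natrM ler_nat bin2 muln2.
by rewrite halfK (leq_trans (leq_subr _ _)) // leq_mul // leq_pred.
Qed.

Lemma density_ge0 : 0 <= p.
Proof.
rewrite -(mean_const V_gt0 0); apply: mean_le => x.
by case/andP: (mean_bool_itv R V_gt0 (a x)).
Qed.

Lemma mean_seq_edges_tail (k : nat) (c : R) : 0 < c ->
  mean_seq k (fun A => (c <= (edges a A)%:R)%R%:R) <= k%:R ^+ 2 / 2 * p / c.
Proof.
move=> c0.
have edges_ge0 A : size A = k -> (0 : R) <= (edges a A)%:R by rewrite ler0n.
apply: le_trans (markov_mean_seq c0 edges_ge0) _.
rewrite mean_seq_edges // ler_wpM2r ?invr_ge0 ?(ltW c0) //.
by rewrite ler_wpM2r ?density_ge0 ?bin2_le.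
Qed.

Let mu : R := mean (fun b => (middling R a b)%:R).

Definition agreement (S S' : seq V) : R :=
  mean (fun b => (middling R a b && (count (a b) S == count (a b) S'))%:R).

(** With [b] and [S] fixed, the degree of [b] into [S'] has to hit one prescribed value. *)
Lemma mean_seq_agreement (N s : nat) : (0 < N)%N ->
  400 * N%:R ^+ 2 <= s%:R * p ->
  mean_seq s (fun S => mean_seq s (agreement S)) <= 2 / N%:R * mu.
Proof.
move=> N0 hs; under eq_mean_seq => S _ do rewrite mean_seq_mean.
rewrite mean_seq_mean -meanZ; apply: mean_le => b.
rewrite -[leRHS](mean_seq_const V_gt0 s); apply: mean_seq_le => S _.
case: (boolP (middling R a b)) => mid /=.
  rewrite mulr1; under eq_mean_seq => S' _ do rewrite eq_sym.
  exact: degree_spread.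
by rewrite mean_seq_const // mulr0.
Qed.

(** If both counts are [l], the edges inside [B] cancel, and the degree differences sum over [B] to
    e(S') - e(S), which is below k / 8 in absolute value. *)
Lemma both_bound (N k m s l : nat) (S S' : seq V) :
  (0 < N)%N -> (0 < s)%N -> (0 < k)%N ->
  k%:R <= 2 * m%:R :> R -> 48 * N%:R ^+ 3 * s%:R <= k%:R :> R ->
  16 * N%:R ^+ 2 / m%:R <= mu / 2 ->
  size S = s -> size S' = s ->
  (edges a S)%:R < k%:R / 8 :> R -> (edges a S')%:R < k%:R / 8 :> R ->
  agreement S S' < mu / 2 ->
  mean_seq m (fun B => ((edges a (S ++ B) == l) && (edges a (S' ++ B) == l))%:R)
    <= 2 / N%:R :> R.
Proof.
move=> N0 s0 k0 km hs mu_lo sS sS' eS eS' agr.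
(* Adding [s] makes the difference of degrees a natural number; the value [s] means equal
   degrees. *)
pose f b := (count (a b) S + (s - count (a b) S'))%N.
have cnt_le b : (count (a b) S' <= s)%N by rewrite -sS' count_size.
have cnt_le' b : (count (a b) S <= s)%N by rewrite -sS count_size.
have eS0 : (0 : R) <= (edges a S)%:R by [].
have eS0' : (0 : R) <= (edges a S')%:R by [].
(* Makes the truncated subtraction in [t] exact. *)
have edges_le : (edges a S <= edges a S' + s * m)%N.
  apply: leq_trans (_ : m <= _)%N; last first.
    by rewrite (leq_trans _ (leq_addl _ _)) // leq_pmull.
  by rewrite -(ler_nat R); move: eS eS0 km; clear -p mu V_gt0 a_sym; lra.
pose t := (edges a S' + s * m - edges a S)%N.
have tR : t%:R - s%:R * m%:R = (edges a S')%:R - (edges a S)%:R :> R.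
  by rewrite /t natrB // natrD natrM; ring.
apply: le_trans (_ : mean_seq m (fun B => (\sum_(b <- B) f b == t)%N%:R) <= _).
  apply: mean_seq_le => B sB; case: andP => // -[/eqP E /eqP E'].
  rewrite (_ : (_ == t)%N) //; apply/eqP.
  move: E E'; rewrite !edges_cat // => <-.
  have : (\sum_(b <- B) f b + \sum_(b <- B) count (a b) S' =
          \sum_(b <- B) count (a b) S + s * m)%N.
    rewrite -sB -sum1_size big_distrr /= -!big_split /=.
    by apply: eq_bigr => b _; rewrite /f muln1 -addnA subnK.
  move: edges_le; rewrite /t.
  move: (edges a S) (edges a S') (edges a B) (s * m)%N (\sum_(b <- B) f b)%N.
  move: (\sum_(b <- B) count (a b) S)%N (\sum_(b <- B) count (a b) S')%N.
  by clear=> *; lia.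
apply: (@sum_avoid_shifted_mean _ _ V_gt0 f k m s) => //.
- by move=> b; apply: leq_add => //; apply: leq_subr.
- apply: le_trans mu_lo _.
  (* A middling vertex has equal degrees into [S] and [S'] or satisfies [f b != s]; the first kind
     has mass below mu / 2. *)
  have : mu <= agreement S S' + mean (fun v => (f v != s)%:R).
    rewrite -meanD; apply: mean_le => b.
    case: middling => //=; last by rewrite add0r.
    case: eqP => E /=; first by rewrite lerDl.
    rewrite (_ : f b != s) ?add0r //; apply/eqP => fs; apply: E.
    move: fs (cnt_le b); rewrite /f.
    by move: (count _ S) (count _ S'); clear=> *; lia.
  by move: agr; clear -p mu V_gt0 a_sym; lra.
- rewrite tR -ler_pdivlMl // mulrC ler_norml.
  move: eS eS' eS0 eS0'; clear -p mu V_gt0 a_sym => *.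
  by apply/andP; split; lra.
Qed.

(** Two indicators add up to at most 1 plus that of their conjunction. When the pair violates a
    smallness condition of [both_bound], the matching term on the right is at least 1 and absorbs
    the trivial bound. *)
Lemma coupled_pair_bound (N k m s l : nat) (S S' : seq V) :
  (0 < N)%N -> (0 < s)%N -> (0 < k)%N -> 0 < mu ->
  k%:R <= 2 * m%:R :> R -> 48 * N%:R ^+ 3 * s%:R <= k%:R :> R ->
  16 * N%:R ^+ 2 / m%:R <= mu / 2 ->
  size S = s -> size S' = s ->
  mean_seq m (fun B => (edges a (S ++ B) == l)%:R + (edges a (S' ++ B) == l)%:R)
  <= 1 + 2 / N%:R + ((k%:R / 8 <= (edges a S)%:R :> R)%R%:R +
       (k%:R / 8 <= (edges a S')%:R :> R)%R%:R + 2 / mu * agreement S S').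
Proof.
move=> N0 s0 k0 mu0 km hs mu_lo sS sS'.
have muZ : 0 <= 2 / mu * agreement S S'.
  apply: mulr_ge0; first by apply: divr_ge0 => //; exact: ltW.
  by case/andP: (mean_bool_itv R V_gt0
    (fun b => middling R a b && (count (a b) S == count (a b) S'))).
have N_ge0 : 0 <= 2 / N%:R :> R by rewrite divr_ge0.
pose both B : R := ((edges a (S ++ B) == l) && (edges a (S' ++ B) == l))%:R.
apply: le_trans (_ : 1 + mean_seq m both <= _).
  rewrite -[X in _ <= X + _](mean_seq_const V_gt0 m) -mean_seqD.
  apply: mean_seq_le => B _.
  exact: indicator_add_le.
have both1 : mean_seq m both <= 1.
  rewrite -[leRHS](mean_seq_const V_gt0 m); apply: mean_seq_le => B _.
  by rewrite /both; case: andP.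
rewrite -addrA lerD2l.
have [bS | gS] := boolP (k%:R / 8 <= (edges a S)%:R :> R).
  apply: le_trans both1 _; rewrite -[leLHS]add0r lerD //.
  by rewrite -addrA lerDl addr_ge0.
have [bS' | gS'] := boolP (k%:R / 8 <= (edges a S')%:R :> R).
  apply: le_trans both1 _; rewrite -[leLHS]add0r lerD //.
  by rewrite add0r lerDl.
have [bZ | gZ] := lerP (mu / 2) (agreement S S').
  apply: le_trans both1 _; rewrite -[leLHS]add0r lerD // !add0r.
  rewrite mulrAC ler_pdivlMr // mul1r.
  by move: bZ; clear -p mu V_gt0 a_sym; lra.
rewrite !add0r; apply: le_trans (_ : 2 / N%:R <= _); last by rewrite lerDl.
by apply: (@both_bound N k m s) => //; rewrite ltNge.
Qed.

(** [T] is the order of the average degree into [S]. The lower bound on [s * p] serves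
    [degree_spread]; the one on [k * p] lets e(S), of mean at most s^2 p / 2, reach k / 8 with
    probability at most 1 / N. *)
Lemma coupling_bound (N k l s : nat) : (0 < N)%N ->
  0 < p -> p <= 1 / 2 ->
  let T : R := 400 * N%:R ^+ 2 in
  T <= s%:R * p -> s%:R * p <= 2 * T -> 16 * N%:R * T ^+ 2 <= k%:R * p ->
  mean_seq k (fun A => (edges a A == l)%:R) <= 1 / 2 + 4 / N%:R :> R.
Proof.
move=> N0 p0 p_half T s_lo s_hi k_lo.
have N1 : (1 : R) <= N%:R by rewrite ler1n.
set n : R := N%:R in N1 T s_lo s_hi k_lo *.
have n0 : 0 < n by apply: lt_le_trans N1.
have n2 : 1 <= n ^+ 2 by rewrite exprn_ege1.
have TE : T = 400 * n ^+ 2 by [].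
clearbody T.
have T1 : 400 <= T by move: n2 TE; clear -p mu V_gt0 a_sym; lra.
have T0 : 0 < T by move: T1; clear -p mu V_gt0 a_sym; lra.
have nT : 400 <= n * T by move: N1 T1; clear -p mu V_gt0 a_sym; nra.
(* Multiply [k_lo] by [s_hi] and cancel 2 T p. *)
have sk : 8 * (n * T) * s%:R <= k%:R.
  rewrite -(ler_pM2r p0) -(@ler_pM2r _ (2 * T)) ?mulr_gt0 //.
  apply: le_trans (_ : 16 * n * T ^+ 2 * (s%:R * p) <= _).
    by rewrite le_eqVlt; apply/orP; left; apply/eqP; ring.
  apply: ler_pM => //; last by rewrite mulr_ge0 // ltW.
    by rewrite mulr_ge0 ?sqr_ge0 // mulr_ge0 // ltW.
have s0 : (0 < s)%N.
  rewrite lt0n; apply/eqP => E; move: s_lo; rewrite E mul0r leNgt.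
  by rewrite T0.
have s1 : (1 : R) <= s%:R by rewrite ler1n.
have sk' : 3200 * s%:R <= k%:R :> R.
  apply: le_trans sk; rewrite ler_wpM2r //.
  by move: nT; clear -p mu V_gt0 a_sym; lra.
have [s_le k0] : (s <= k /\ 0 < k)%N.
  rewrite -(ler_nat R) -(ltr0n R); move: s1 sk'.
  by clear -p mu V_gt0 a_sym; split; lra.
set m := (k - s)%N; have kE : k = (s + m)%N by rewrite /m subnKC.
have kR : k%:R = s%:R + m%:R :> R by rewrite kE natrD.
have km : k%:R <= 2 * m%:R :> R.
  by move: s1 sk' kR; clear -p mu V_gt0 a_sym; lra.
have kpos : (0 : R) < k%:R by rewrite ltr0n.
have mpos : (0 : R) < m%:R by move: kpos km; clear -p mu V_gt0 a_sym; lra.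
have mu_lo : p / 20 <= mu by apply: mean_middling.
have mu0 : 0 < mu by apply: lt_le_trans mu_lo; rewrite divr_gt0.
have hs : 48 * n ^+ 3 * s%:R <= k%:R.
  apply: le_trans sk; rewrite ler_wpM2r // TE.
  by have := exprn_ge0 3 (ltW n0); clear -p mu V_gt0 a_sym; lra.
have mu_m : 16 * n ^+ 2 / m%:R <= mu / 2.
  rewrite ler_pdivrMr //.
  have : 1280 * n ^+ 2 <= k%:R * p.
    apply: le_trans k_lo.
    have := ler_wpM2r (ltW T0) nT; move: n2 TE.
    by clear -p mu V_gt0 a_sym; lra.
  have := ler_wpM2r (ltW p0) km; have := ler_wpM2r (ltW mpos) mu_lo.
  by clear -p mu V_gt0 a_sym; lra.
set q := mean_seq k _.
pose ind A : R := (edges a A == l)%:R.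
pose heavy (S : seq V) : R := (k%:R / 8 <= (edges a S)%:R :> R)%R%:R.
have heavy_mean : mean_seq s heavy <= 1 / n.
  have k8 : (0 : R) < k%:R / 8 by rewrite divr_gt0.
  apply: le_trans (mean_seq_edges_tail s k8) _.
  rewrite ler_pdivrMr // -(ler_pM2r p0) -(ler_pM2r n0).
  have -> : 1 / n * (k%:R / 8) * p * n = k%:R * p / 8 by field; rewrite gt_eqF.
  have -> : s%:R ^+ 2 / 2 * p * p * n = (s%:R * p) ^+ 2 * n / 2 by field.
  have : (s%:R * p) ^+ 2 * n <= (2 * T) ^+ 2 * n.
    apply: ler_wpM2r; first exact: ltW.
    by apply: lerXn2r => //; rewrite nnegrE mulr_ge0 // ltW.
  by move: k_lo; clear -p mu V_gt0 a_sym; lra.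
(* [S ++ B] and [S' ++ B] are both uniform [k]-tuples. *)
have qq : q + q = mean_seq s (fun S => mean_seq s (fun S' =>
    mean_seq m (fun B => ind (S ++ B) + ind (S' ++ B)))).
  have qE : q = mean_seq s (fun S => mean_seq m (fun B => ind (S ++ B))).
    by rewrite /q kE mean_seq_cat.
  under [RHS]eq_mean_seq => S _.
    under eq_mean_seq => S' _ do rewrite mean_seqD.
    rewrite mean_seqD mean_seq_const // -qE; over.
  by rewrite mean_seqD mean_seq_const // -qE.
(* The errors are 2 / n from [both_bound], 1 / n for each heavy block and 4 / n for agreement, 8 / n
   in all for [q + q]. *)
have : q + q <= 1 + 2 / n + (1 / n + 1 / n + 2 / mu * (2 / n * mu)).
  rewrite qq.
  apply: le_trans (_ : mean_seq s (fun S => mean_seq s (fun S' =>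
    1 + 2 / n + (heavy S + heavy S' + 2 / mu * agreement S S'))) <= _).
    apply: mean_seq_le => S sS; apply: mean_seq_le => S' sS'.
    exact: (@coupled_pair_bound N k m s).
  under eq_mean_seq => S _.
    rewrite !mean_seqD !mean_seq_const // mean_seqZ; over.
  rewrite !mean_seqD !mean_seq_const // mean_seqZ.
  rewrite lerD2l !lerD //; apply: ler_wpM2l.
    by apply: divr_ge0 => //; exact: ltW.
  by apply: mean_seq_agreement => //; rewrite -/n -TE.
have -> : 2 / mu * (2 / n * mu) = 4 / n.
  by field; rewrite !gt_eqF.
by clear -p mu V_gt0 a_sym; lra.
Qed.

(* Below density C / k, Markov's inequality alone gives 1 / 2. *)
Lemma sparse_bound (k l : nat) (C : R) : (0 < k)%N -> 0 < C ->
  C * k%:R <= l%:R -> k%:R * p <= C ->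
  mean_seq k (fun A => (edges a A == l)%:R) <= 1 / 2 :> R.
Proof.
move=> k0 C0 hl hp.
have kpos : (0 : R) < k%:R by rewrite ltr0n.
have lpos : (0 : R) < l%:R by apply: lt_le_trans hl; rewrite mulr_gt0.
apply: le_trans
  (_ : mean_seq k (fun A => (l%:R <= (edges a A)%:R :> R)%R%:R) <= _).
  by apply: mean_seq_le => A _; case: eqP => // ->; rewrite lexx.
apply: le_trans (mean_seq_edges_tail k lpos) _.
rewrite ler_pdivrMr //; have := ler_wpM2r (ltW kpos) hp; nra.
Qed.

End Bound.

(** * Passage to the complement and choice of the block size *)

Lemma density_compl (R : realFieldType) (V : finType) (a : rel V) :
  (0 < #|V|)%N -> density R (fun x y => ~~ a x y) = 1 - density R a.
Proof.
move=> V_gt0; apply/eqP; rewrite eq_sym subr_eq -meanD; apply/eqP.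
rewrite -[LHS](mean_const V_gt0); apply: eq_mean => x.
by rewrite /deg meanC // subrK.
Qed.

(** This is 16 N T^2 with T = 400 N^2, the lower bound that [coupling_bound] asks of [k * p]. *)
Definition size_constant (R : realFieldType) (N : nat) : R :=
  16 * N%:R * (400 * N%:R ^+ 2) ^+ 2.

Lemma size_constant_gt0 (R : realFieldType) (N : nat) :
  (0 < N)%N -> 0 < size_constant R N.
Proof.
move=> N0; have N1 : (1 : R) <= N%:R by rewrite ler1n.
have N2 : (1 : R) <= N%:R ^+ 2 by rewrite exprn_ege1.
by apply: mulr_gt0; [|apply: exprn_gt0]; lra.
Qed.

Lemma edges_bound (R : archiRealFieldType) (V : finType) (a : rel V)
    (N k l : nat) :
  (0 < #|V|)%N -> symmetric a -> (0 < N)%N -> (0 < k)%N ->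
  let C : R := size_constant R N in
  C * k%:R <= l%:R -> l%:R <= 'C(k, 2)%:R - C * k%:R ->
  mean_seq k (fun A => (edges a A == l)%:R) <= 1 / 2 + 4 / N%:R :> R.
Proof.
move=> V_gt0 a_sym N0 k0 C.
have N1 : (1 : R) <= N%:R by rewrite ler1n.
have C0 : 0 < C := size_constant_gt0 R N0.
have fourN : 0 <= 4 / N%:R :> R by rewrite divr_ge0.
wlog p_half : a l a_sym / density R a <= 1 / 2 => [wl lo hi|lo _].
  have [h | h] := lerP (density R a) (1 / 2); first exact: wl.
  have l_le : (l <= 'C(k, 2))%N.
    rewrite -(ler_nat R); apply: le_trans hi _.
    by rewrite gerBl mulr_ge0 // ltW.
  (* Complementing turns [l] into ['C(k, 2) - l], which exchanges the two hypotheses on [l]. *)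
  pose b x y := ~~ a x y.
  rewrite (@eq_mean_seq _ _ _ _ (fun A => (edges b A == 'C(k, 2) - l)%N%:R)).
    apply: wl => //.
    - by move=> x y; rewrite /b a_sym.
    - by rewrite density_compl //; lra.
    - by rewrite natrB //; lra.
    - by rewrite natrB //; lra.
  move=> A sA; have := edges_compl a A; rewrite sA -/b => E.
  congr (nat_of_bool _)%:R; apply/eqP/eqP; move: E l_le.
    by move: (edges a A) (edges b A) 'C(k, 2); clear => *; lia.
  by move: (edges a A) (edges b A) 'C(k, 2); clear => *; lia.
have [h | h] := lerP (k%:R * density R a) C.
  by apply: le_trans (sparse_bound V_gt0 k0 C0 lo h) _; rewrite lerDl.
have kpos : (0 : R) < k%:R by rewrite ltr0n.
have p0 : 0 < density R a by rewrite -(pmulr_rgt0 _ kpos); apply: lt_trans h.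
set T : R := 400 * N%:R ^+ 2.
have N2 : (1 : R) <= N%:R ^+ 2 by rewrite exprn_ege1.
have T1 : 1 <= T by rewrite /T; move: N2; clear; lra.
(* The block size is [s.+1]: with p the density, T <= (s + 1) p <= T + p <= 2 T. *)
pose s := Num.truncn (T / density R a).
have /andP[s_lo s_hi] : s%:R <= T / density R a < s.+1%:R.
  by apply/truncn_itv/divr_ge0; [apply: le_trans T1 | apply: ltW].
apply: (@coupling_bound _ _ V_gt0 a a_sym N k l s.+1) => //.
- by rewrite -ler_pdivrMr // ltW.
- rewrite -natr1 mulrDl mul1r -/T.
  have : s%:R * density R a <= T by rewrite -ler_pdivlMr.
  lra.
- exact: ltW.
Qed.

(** * From random subsets to random tuples *)

(** When [v] joins [s], the new edges are those containing [v]; by simplicity each is [[set v; y]]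
    for one [y] in [s], so they match the neighbours of [v] in [s]. *)
Lemma card_induced_edges (T : finType) (E : {set {set T}}) (s : seq T) :
  simple_graph E -> uniq s ->
  #|induced_edges E [set x in s]%SET| =
  edges (fun x y => [set x; y]%SET \in E) s.
Proof.
move=> /forall_inP simpleE; elim: s => [|v s IH] /=.
  move=> _; apply/eqP; rewrite cards_eq0 -finset.subset0.
  apply/fintype.subsetP => e.
  rewrite inE => /andP[eE]; have := simpleE _ eE.
  move=> /cards2P[x [y [_ ->]]] /fintype.subsetP /(_ x).
  by rewrite !inE eqxx => /(_ isT).
case/andP=> vs us; rewrite -(IH us) addnC.
pose nbr := [set y in s | [set v; y]%SET \in E]%SET.
have -> : count (fun y => [set v; y]%SET \in E) s = #|nbr|.
  rewrite -size_filter -(card_uniqP (filter_uniq _ us)); apply: eq_card => y.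
  by rewrite !inE mem_filter andbC.
have inj_nbr : {in nbr &, injective (fun y => [set v; y]%SET)}.
  move=> y z; rewrite !inE => /andP[ys _] /andP[zs _] /setP /(_ y).
  rewrite !inE eqxx orbT => /esym /orP[] /eqP // yv.
  by move: vs; rewrite -yv ys.
rewrite -(card_in_imset inj_nbr) -cardsUI.
rewrite [(_ :&: _)%SET](_ : _ = finset.set0) ?cards0 ?addn0.
  apply: eq_card => e; rewrite !inE; apply/andP/orP.
    move=> [eE es]; case: (boolP (v \in e)) => ve.
      right; have /cards2P[x [y [xy e_xy]]] := simpleE _ eE.
      have [z zv ez] : exists2 z, z != v & e = [set v; z]%SET.
        move: ve; rewrite e_xy !inE => /orP[] /eqP vE.
          by exists y; rewrite vE // eq_sym.
        by exists x; rewrite vE // finset.setUC.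
      apply/imsetP; exists z => //; rewrite !inE -ez eE andbT.
      move/fintype.subsetP: es => /(_ z).
      by rewrite ez !inE eqxx orbT (negPf zv); apply.
    left; rewrite eE /=; apply/fintype.subsetP => x xe.
    move/fintype.subsetP: es => /(_ x xe); rewrite !inE => /orP[] // /eqP xv.
    by move: ve; rewrite -xv xe.
  case=> [/andP[eE es]|/imsetP[y]].
    split=> //; apply: fintype.subset_trans es _; apply/fintype.subsetP => x.
    by rewrite !inE => ->; rewrite orbT.
  rewrite inE => /andP[ys vy] ->; split=> //; apply/fintype.subsetP => x.
  by rewrite !inE => /orP[] /eqP ->; rewrite ?eqxx ?ys ?orbT.
apply/eqP; rewrite -finset.subset0; apply/fintype.subsetP => e.
rewrite !inE => /andP[/andP[_ /fintype.subsetP es] /imsetP[y _ eE]].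
by move: (es v); rewrite eE !inE eqxx (negPf vs) => /(_ isT).
Qed.

(** Each [k]-subset is the image of exactly k! repetition-free tuples. *)
Lemma card_tuples_of_ksubsets (T : finType) (k : nat) (P : pred {set T}) :
  (#|[set A in ksubsets T k | P A]%SET| * k`!)%N =
  #|[set t : k.-tuple T | uniq t && P [set x in t]%SET]%SET|.
Proof.
rewrite -[RHS]sum1_card.
rewrite (partition_big (fun t : k.-tuple T => [set x in t]%SET)
  (mem [set A in ksubsets T k | P A]%SET)) /=; last first.
  move=> t; rewrite !inE => /andP[ut ->]; rewrite andbT.
  by rewrite cardsE (card_uniqP ut) size_tuple.
rewrite -sum_nat_const; apply: eq_bigr => A; rewrite !inE => /andP[/eqP Ak PA].
rewrite -(ffactnn k) -{1}Ak -card_uniq_tuples -sum1_card.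
apply: eq_bigl => t; rewrite !inE.
apply/andP/andP => [[/allP tA ut]|[/andP[ut _] /eqP <-]]; last first.
  split=> //; apply/allP => x xt.
  by have : x \in [set x in t]%SET by rewrite inE.
have tE : [set x in t]%SET = A.
  apply/eqP; rewrite eqEcard cardsE (card_uniqP ut) size_tuple Ak leqnn andbT.
  by apply/fintype.subsetP => x; rewrite inE => /tA.
by rewrite tE ut PA eqxx.
Qed.

(** Divided by n^k, the right side is the probability that [k] draws are distinct. The next factor 1
    - k / n costs less than the increment (2 k + 1) / n of k^2 / n. *)
Lemma ffact_ge (R : realFieldType) (n k : nat) : (0 < n)%N ->
  n%:R ^+ k * (1 - k%:R ^+ 2 / n%:R) <= (n ^_ k)%:R :> R.
Proof.
move=> n0; have n_gt0 : (0 : R) < n%:R by rewrite ltr0n.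
elim: k => [|k IH]; first by rewrite expr0n mul0r subr0 mulr1.
have k0 : (0 : R) <= k%:R by [].
have V0 : (0 : R) <= n%:R^-1 by rewrite invr_ge0 ltW.
rewrite ffactnSr natrM exprSr -mulrA.
case: (leqP k n) => kn; last first.
  (* For k > n the falling factorial of order k + 1 vanishes and the left side is at most 0. *)
  rewrite (eqP (ltnW kn)) mulr0 mulr_ge0_le0 ?exprn_ge0 ?(ltW n_gt0) //.
  rewrite mulr_ge0_le0 ?(ltW n_gt0) // subr_le0 ler_pdivlMr // mul1r.
  have : n%:R <= k%:R :> R by rewrite ler_nat ltnW.
  rewrite -natr1; nra.
have kn' : k%:R <= n%:R :> R by rewrite ler_nat.
rewrite natrB //; have nk : 0 <= n%:R - k%:R :> R by rewrite subr_ge0.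
apply: le_trans (ler_wpM2r nk IH); rewrite -[leRHS]mulrA.
rewrite ler_wpM2l ?exprn_ge0 ?(ltW n_gt0) //.
have -> : n%:R * (1 - k.+1%:R ^+ 2 / n%:R) = n%:R - k.+1%:R ^+ 2 :> R.
  by field; rewrite gt_eqF.
have -> : (1 - k%:R ^+ 2 / n%:R) * (n%:R - k%:R) =
    n%:R - k%:R ^+ 2 - k%:R + k%:R ^+ 3 / n%:R :> R.
  by field; rewrite gt_eqF.
have : 0 <= k%:R ^+ 3 / n%:R :> R by rewrite mulr_ge0 ?exprn_ge0.
rewrite -natr1; nra.
Qed.

(** A random [k]-subset is a random tuple conditioned on distinct entries, so its probability times
    that of distinctness is at most the tuple probability. *)
Lemma prob_edges_le_mean_seq (R : realType) (T : finType) (E : {set {set T}})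
    (k l : nat) : (0 < #|T|)%N -> simple_graph E ->
  prob_edges R E k l <=
  mean_seq k (fun s => (edges (fun x y => [set x; y]%SET \in E) s == l)%:R)
  + k%:R ^+ 2 / #|T|%:R.
Proof.
move=> T0 simpleE; set q : R := mean_seq _ _.
have n0 : (0 : R) < #|T|%:R by rewrite ltr0n.
have x0 : 0 <= k%:R ^+ 2 / #|T|%:R :> R by rewrite divr_ge0 // ltW.
have q0 : 0 <= q.
  by rewrite -(mean_seq_const T0 k 0); apply: mean_seq_le => s _.
rewrite /prob_edges; set G := [set A in _ | _]%SET; set K := ksubsets T k.
(* Without any [k]-subset the quotient is 0 / 0 = 0. *)
have [->|K0] := eqVneq #|K| 0%N; first by rewrite invr0 mulr0 addr_ge0.
have K_gt0 : (0 : R) < #|K|%:R by rewrite ltr0n lt0n.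
have GK : (#|G| <= #|K|)%N.
  by apply/subset_leq_card/fintype.subsetP => A; rewrite inE => /andP[].
set pr := _ / _.
have pr1 : pr <= 1 by rewrite ler_pdivrMr // mul1r ler_nat.
have pr0 : 0 <= pr by rewrite divr_ge0.
have KE : (#|K| * k`!)%N = #|T| ^_ k by rewrite card_draws bin_ffact.
have Gq : (#|G| * k`!)%:R <= #|T|%:R ^+ k * q.
  rewrite /G (card_tuples_of_ksubsets k (fun A => #|induced_edges E A| == l)).
  rewrite /q mean_seq_tuple mulrC divfK ?expf_neq0 ?gt_eqF //.
  rewrite -sum1_card natr_sum big_mkcond ler_sum // => t _.
  rewrite inE; case: (boolP (uniq t)) => //= ut.
  by rewrite card_induced_edges //; case: eqP.
have prK : pr * (#|T| ^_ k)%:R = (#|G| * k`!)%:R.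
  by rewrite -KE !natrM /pr; field; rewrite gt_eqF.
have nk : (0 : R) < #|T|%:R ^+ k by rewrite exprn_gt0.
have : pr * (1 - k%:R ^+ 2 / #|T|%:R) <= q.
  rewrite -(ler_pM2l nk) mulrCA; apply: le_trans Gq; rewrite -prK.
  by rewrite ler_wpM2l // ffact_ge.
move: x0; set x := k%:R ^+ 2 / _ => x0; nra.
Qed.

(** * Bound for each [n] and passage to the limit *)

Lemma max_prob_bound (R : realType) (N n k l : nat) :
  (0 < N)%N -> (0 < k)%N -> (0 < n)%N ->
  let C : R := size_constant R N in
  C * k%:R <= l%:R -> l%:R <= 'C(k, 2)%:R - C * k%:R ->
  max_prob R n k l <= 1 / 2 + 4 / N%:R + k%:R ^+ 2 / n%:R.
Proof.
move=> N0 k0 n0 C lo hi.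
have bound0 : 0 <= 1 / 2 + 4 / N%:R + k%:R ^+ 2 / n%:R :> R.
  by rewrite !addr_ge0 ?divr_ge0.
apply: (big_ind (fun x => x <= _)) => // [x y xb yb|E simpleE].
  by rewrite ge_max xb.
have n0' : (0 < #|'I_n|)%N by rewrite card_ord.
apply: le_trans (prob_edges_le_mean_seq R k l n0' simpleE) _.
rewrite card_ord lerD2r; apply: edges_bound => // x y.
by rewrite finset.setUC.
Qed.

Theorem proposition1p4 (R : realType) (eps : R) (heps : 0 < eps) :
  exists (C : R) (k0 : nat),
    [/\ 0 < C, (0 < k0)%N &
      forall k l : nat,
        (k0 <= k)%N ->
        C * k%:R <= l%:R ->
        l%:R <= 'C(k, 2)%:R - C * k%:R ->
        ind R k l <= 1 / 2 + eps].
Proof.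
(* As N > 8 / eps, the error 4 / N takes at most half of [eps]; the other half is left for k^2 /
   n. *)
pose N := (Num.truncn (8 / eps)).+1.
have N0 : (0 : R) < N%:R by [].
have hN : 4 / N%:R <= eps / 2.
  have : 8 / eps < N%:R by apply: truncnS_gt.
  rewrite ltr_pdivrMr // ler_pdivrMr //; lra.
exists (size_constant R N), 1%N; split; [exact: size_constant_gt0 | by [] |].
move=> k l k0 lo hi; rewrite /ind.
(* In the divergent case [limn] takes the default value 0, which satisfies the bound. *)
have [cv|ncv] := pselect (cvgn (fun n => max_prob R n k l)); last first.
  rewrite (dvgP ncv).
  have -> : (point : R) = 0 by [].
  by rewrite addr_ge0 ?divr_ge0 // ltW.
apply: limr_le => //.
pose M := (Num.truncn (2 * k%:R ^+ 2 / eps)).+1.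
exists M => // n /= Mn.
have n0 : (0 < n)%N by apply: leq_trans Mn.
have nR : (0 : R) < n%:R by rewrite ltr0n.
apply: le_trans (@max_prob_bound R N n k l isT k0 n0 lo hi) _.
have : k%:R ^+ 2 / n%:R <= eps / 2.
  have : 2 * k%:R ^+ 2 / eps < M%:R by apply: truncnS_gt.
  have : M%:R <= n%:R :> R by rewrite ler_nat.
  move=> Mn' /lt_le_trans /(_ Mn'); rewrite ltr_pdivrMr // ler_pdivrMr //; lra.
lra.
Qed.
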